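(* Let $(\mathfrak g,[-,-],\delta)$ be a Lie bialgebra over a field $k$ and let $\mathcal D=[-,-]\circ\delta:\mathfrak g\to\mathfrak g$. Then, on $\Lambda^\bullet\mathfrak g$, $$\partial_{CE}\circ\partial_\delta+\partial_\delta\circ\partial_{CE}=-\partial_{\mathcal D},$$ where $\partial_{\mathcal D}:\Lambda^\bullet\mathfrak g\to\Lambda^\bullet\mathfrak g$ is the unique derivation of the exterior algebra that agrees with $\mathcal D$ on $\mathfrak g$: $$\partial_{\mathcal D}(x_1\wedge\cdots\wedge x_n)=\sum_{i=1}^n x_1\wedge\cdots\wedge\mathcal D(x_i)\wedge\cdots\wedge x_n .$$
   Context: A Lie bialgebra over $k$ is a $k$-Lie algebra $\mathfrak g$ with a linear map $\delta:\mathfrak g\to\Lambda^2\mathfrak g$ such that $\delta$ satisfies the co-Jacobi condition ($\delta^*:\Lambda^2\mathfrak g^*\to\mathfrak g^*$ is a Lie bracket) and the 1-cocycle condition $\delta[x,y]=\mathrm{ad}_x(\delta y)-\mathrm{ad}_y(\delta x)$. The map $[-,-]:\Lambda^2\mathfrak g\to\mathfrak g$ is $x\wedge y\mapsto[x,y]$. The Chevalley--Eilenberg differential $\partial_{CE}:\Lambda^\bullet\mathfrak g\to\Lambda^{\bullet-1}\mathfrak g$ is $$\partial_{CE}(x_1\wedge\cdots\wedge x_n)=\sum_{i<j}(-1)^{i+j}[x_i,x_j]\wedge x_1\wedge\cdots\widehat{x_i}\cdots\widehat{x_j}\cdots\wedge x_n$$ (so $\partial_{CE}(x\wedge y)=-[x,y]$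 and $\partial_{CE}$ vanishes on $\Lambda^0$ and $\Lambda^1$). The map $\partial_\delta:\Lambda^\bullet\mathfrak g\to\Lambda^{\bullet+1}\mathfrak g$ is the unique superderivation of degree $+1$ of the exterior product ($\partial_\delta(ab)=\partial_\delta(a)b+(-1)^{|a|}a\,\partial_\delta(b)$) with $\partial_\delta|_{\mathfrak g}=\delta$. *)

(* Defs.v *)
From HB Require Import structures.
From mathcomp Require Import all_boot all_algebra.
From mathcomp Require Import boolp.

Set Implicit Arguments.
Unset Strict Implicit.
Unset Printing Implicit Defensive.

Import GRing.Theory.
Local Open Scope ring_scope.
Local Open Scope quotient_scope.

Definition definite (T : Type) (P : T -> Prop) (h : exists! x, P x) : T :=
  projT1 (cid h).

Lemma definiteP (T : Type) (P : T -> Prop) (h : exists! x, P x) :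
  P (definite h).
Proof. by rewrite /definite; case: cid => x [Px]. Qed.

Lemma linear_ext (k : fieldType) (U V : lmodType k) (f g : {linear U -> V}) :
  f =1 g -> f = g.
Proof.
case: f g => [f [[hf] [sf]]] [g [[hg] [sg]]] /= /funext E.
move: hf sf hg sg; rewrite E => hf sf hg sg.
by rewrite (Prop_irrelevance hf hg) (Prop_irrelevance sf sg).
Qed.

(* The exterior algebra: the unital associative k-algebra generated by the
   elements of V, subject to linearity of the generators and v * v = 0. *)
Section ExteriorAlgebra.
Variables (k : fieldType) (V : lmodType k).

Inductive ext_term : Type :=
| TVar of V
| TZero
| TOne
| TAdd of ext_term & ext_term
| TMul of ext_term & ext_term
| TScale of k & ext_term.

HB.instance Definition _ := gen_eqMixin ext_term.
HB.instance Definition _ := gen_choiceMixin ext_term.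

Inductive ext_rel : ext_term -> ext_term -> Prop :=
| er_refl s : ext_rel s s
| er_sym s t : ext_rel s t -> ext_rel t s
| er_trans s t u : ext_rel s t -> ext_rel t u -> ext_rel s u
| er_add s s' t t' :
    ext_rel s s' -> ext_rel t t' -> ext_rel (TAdd s t) (TAdd s' t')
| er_mul s s' t t' :
    ext_rel s s' -> ext_rel t t' -> ext_rel (TMul s t) (TMul s' t')
| er_scale a s s' : ext_rel s s' -> ext_rel (TScale a s) (TScale a s')
| er_addA s t u : ext_rel (TAdd s (TAdd t u)) (TAdd (TAdd s t) u)
| er_addC s t : ext_rel (TAdd s t) (TAdd t s)
| er_add0 s : ext_rel (TAdd TZero s) s
| er_addN s : ext_rel (TAdd (TScale (-1) s) s) TZero
| er_mulA s t u : ext_rel (TMul s (TMul t u)) (TMul (TMul s t) u)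
| er_mul1l s : ext_rel (TMul TOne s) s
| er_mul1r s : ext_rel (TMul s TOne) s
| er_mulDl s t u : ext_rel (TMul (TAdd s t) u) (TAdd (TMul s u) (TMul t u))
| er_mulDr s t u : ext_rel (TMul s (TAdd t u)) (TAdd (TMul s t) (TMul s u))
| er_scaleA a b s : ext_rel (TScale a (TScale b s)) (TScale (a * b) s)
| er_scale1 s : ext_rel (TScale 1 s) s
| er_scaleDr a s t : ext_rel (TScale a (TAdd s t)) (TAdd (TScale a s) (TScale a t))
| er_scaleDl s a b : ext_rel (TScale (a + b) s) (TAdd (TScale a s) (TScale b s))
| er_scaleAl a s t : ext_rel (TScale a (TMul s t)) (TMul (TScale a s) t)
| er_scaleAr a s t : ext_rel (TScale a (TMul s t)) (TMul s (TScale a t))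
| er_linear a u v : ext_rel (TVar (a *: u + v)) (TAdd (TScale a (TVar u)) (TVar v))
| er_square v : ext_rel (TMul (TVar v) (TVar v)) TZero.

Definition ext_eqb (s t : ext_term) : bool := `[< ext_rel s t >].

Lemma ext_eqb_refl : reflexive ext_eqb.
Proof. by move=> s; apply/asboolP; exact: er_refl. Qed.

Lemma ext_eqb_sym : symmetric ext_eqb.
Proof. by move=> s t; apply/idP/idP => /asboolP h; apply/asboolP; exact: er_sym. Qed.

Lemma ext_eqb_trans : transitive ext_eqb.
Proof.
by move=> t s u /asboolP h /asboolP h'; apply/asboolP; exact: er_trans h h'.
Qed.

Definition ext_equiv := EquivRel ext_eqb ext_eqb_refl ext_eqb_sym ext_eqb_trans.

Definition ext := {eq_quot ext_equiv}.

HB.instance Definition _ := Choice.on ext.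
HB.instance Definition _ := EqQuotient.on ext.

Lemma ext_piP (s t : ext_term) : \pi_ext s = \pi_ext t <-> ext_rel s t.
Proof.
split; last by move=> h; apply/eqP; rewrite piE; apply/asboolP.
by move/eqP; rewrite piE => /asboolP.
Qed.

Lemma ext_reprP (s : ext_term) : ext_rel (repr (\pi_ext s)) s.
Proof. by apply/ext_piP; rewrite reprK. Qed.

Definition ext_zero : ext := \pi_ext TZero.
Definition ext_one : ext := \pi_ext TOne.
Definition ext_add (x y : ext) : ext := \pi_ext (TAdd (repr x) (repr y)).
Definition ext_mul (x y : ext) : ext := \pi_ext (TMul (repr x) (repr y)).
Definition ext_scale (a : k) (x : ext) : ext := \pi_ext (TScale a (repr x)).
Definition ext_in (v : V) : ext := \pi_ext (TVar v).

Lemma ext_addE s t : ext_add (\pi_ext s) (\pi_ext t) = \pi_ext (TAdd s t).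
Proof. by apply/ext_piP; apply: er_add; exact: ext_reprP. Qed.
Lemma ext_mulE s t : ext_mul (\pi_ext s) (\pi_ext t) = \pi_ext (TMul s t).
Proof. by apply/ext_piP; apply: er_mul; exact: ext_reprP. Qed.
Lemma ext_scaleE a s : ext_scale a (\pi_ext s) = \pi_ext (TScale a s).
Proof. by apply/ext_piP; apply: er_scale; exact: ext_reprP. Qed.

Let opE := (ext_addE, ext_mulE, ext_scaleE).

Lemma ext_addrA : associative ext_add.
Proof.
elim/quotW=> s; elim/quotW=> t; elim/quotW=> u.
by rewrite (ext_addE t u) (ext_addE s t) !opE; apply/ext_piP; exact: er_addA.
Qed.
Lemma ext_addrC : commutative ext_add.
Proof.
elim/quotW=> s; elim/quotW=> t.
by rewrite !opE; apply/ext_piP; exact: er_addC.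
Qed.
Lemma ext_add0r : left_id ext_zero ext_add.
Proof. by elim/quotW=> s; rewrite !opE; apply/ext_piP; exact: er_add0. Qed.
Lemma ext_addNr : left_inverse ext_zero (ext_scale (-1)) ext_add.
Proof. by elim/quotW=> s; rewrite (ext_scaleE (-1) s) !opE; apply/ext_piP; exact: er_addN. Qed.

HB.instance Definition _ :=
  GRing.isZmodule.Build ext ext_addrA ext_addrC ext_add0r ext_addNr.

Lemma ext_mulrA : associative ext_mul.
Proof.
elim/quotW=> s; elim/quotW=> t; elim/quotW=> u.
by rewrite (ext_mulE t u) (ext_mulE s t) !opE; apply/ext_piP; exact: er_mulA.
Qed.
Lemma ext_mul1r : left_id ext_one ext_mul.
Proof. by elim/quotW=> s; rewrite !opE; apply/ext_piP; exact: er_mul1l. Qed.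
Lemma ext_mulr1 : right_id ext_one ext_mul.
Proof. by elim/quotW=> s; rewrite !opE; apply/ext_piP; exact: er_mul1r. Qed.
Lemma ext_mulrDl : left_distributive ext_mul ext_add.
Proof.
elim/quotW=> s; elim/quotW=> t; elim/quotW=> u.
by rewrite (ext_addE s t) (ext_mulE s u) (ext_mulE t u) !opE; apply/ext_piP; exact: er_mulDl.
Qed.
Lemma ext_mulrDr : right_distributive ext_mul ext_add.
Proof.
elim/quotW=> s; elim/quotW=> t; elim/quotW=> u.
by rewrite (ext_addE t u) (ext_mulE s t) (ext_mulE s u) !opE; apply/ext_piP; exact: er_mulDr.
Qed.

(* A family of operators L v on a module M, linear in v and with L v (L v m) = 0,
   extends to an action of the exterior algebra. *)
Section TermAction.
Variables (M : lmodType k) (L : V -> M -> M).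
Hypothesis Lr : forall v, linear (L v).
Hypothesis Ll : forall m, linear (L^~ m).
Hypothesis LL : forall v m, L v (L v m) = 0.

Fixpoint term_act (t : ext_term) : M -> M :=
  match t with
  | TVar v => L v
  | TZero => fun=> 0
  | TOne => id
  | TAdd s t => fun m => term_act s m + term_act t m
  | TMul s t => fun m => term_act s (term_act t m)
  | TScale a s => fun m => a *: term_act s m
  end.

Lemma term_act_linear t : linear (term_act t).
Proof.
elim: t => [v||//|s IHs t IHt|s IHs t IHt|b s IHs] a x y /=.
- exact: Lr.
- by rewrite scaler0 addr0.
- by rewrite IHs IHt scalerDr addrACA.
- by rewrite IHt IHs.
- by rewrite IHs scalerDr !scalerA mulrC.
Qed.

Lemma term_act_rel s t : ext_rel s t -> term_act s =1 term_act t.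
Proof.
elim=> {s t} /= [//|s t _ IH m|s t u _ IH1 _ IH2 m|s s' t t' _ IH1 _ IH2 m|
  s s' t t' _ IH1 _ IH2 m|a s s' _ IH m|s t u m|s t m|s m|s m|//|//|//|//|
  s t u m|a b s m|s m|a s t m|s a b m|//|a s t m|a u v m|v m].
- by rewrite IH.
- by rewrite IH1 IH2.
- by rewrite IH1 IH2.
- by rewrite IH1 IH2.
- by rewrite IH.
- by rewrite addrA.
- by rewrite addrC.
- by rewrite add0r.
- by rewrite scaleN1r addNr.
- have := term_act_linear s 1 (term_act t m) (term_act u m).
  by rewrite !scale1r.
- by rewrite scalerA.
- by rewrite scale1r.
- by rewrite scalerDr.
- by rewrite scalerDl.
- have h0 : term_act s 0 = 0.
    by have := term_act_linear s (-1) 0 0; rewrite !scaleN1r oppr0 add0r addNr.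
  by have := term_act_linear s a (term_act t m) 0; rewrite h0 !addr0 => ->.
- exact: Ll.
- exact: LL.
Qed.
End TermAction.

Lemma ext_oner_neq0 : ext_one != ext_zero.
Proof.
apply/eqP => /ext_piP h.
suff /eqP : (1 : k^o) = 0 by rewrite oner_eq0.
have lin0 (U : lmodType k) : linear (fun _ : U => 0 : k^o).
  by move=> a x y; rewrite scaler0 addr0.
exact: (@term_act_rel k^o (fun _ _ => 0) (fun=> lin0 _) (fun=> lin0 _)
  (fun _ _ => erefl) _ _ h 1).
Qed.

HB.instance Definition _ :=
  GRing.Zmodule_isNzRing.Build ext ext_mulrA ext_mul1r ext_mulr1
    ext_mulrDl ext_mulrDr ext_oner_neq0.

Lemma ext_scalerA a b x : ext_scale a (ext_scale b x) = ext_scale (a * b) x.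
Proof. by elim/quotW: x => s; rewrite (ext_scaleE b s) !opE; apply/ext_piP; exact: er_scaleA. Qed.
Lemma ext_scale1r : left_id 1 ext_scale.
Proof. by elim/quotW=> s; rewrite !opE; apply/ext_piP; exact: er_scale1. Qed.
Lemma ext_scalerDr : right_distributive ext_scale +%R.
Proof.
move=> a; elim/quotW=> s; elim/quotW=> t.
by rewrite /GRing.add /= (ext_addE s t) (ext_scaleE a s) (ext_scaleE a t) !opE; apply/ext_piP; exact: er_scaleDr.
Qed.
Lemma ext_scalerDl x : {morph ext_scale^~ x : a b / a + b}.
Proof.
move=> a b; elim/quotW: x => s.
by rewrite [in RHS]/GRing.add /= (ext_scaleE a s) (ext_scaleE b s) !opE; apply/ext_piP; exact: er_scaleDl.
Qed.

HB.instance Definition _ := GRing.Zmodule_isLmodule.Build k ext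
  ext_scalerA ext_scale1r ext_scalerDr ext_scalerDl.

Lemma ext_scalerAl (a : k) (x y : ext) : a *: (x * y) = (a *: x) * y.
Proof.
elim/quotW: x => s; elim/quotW: y => t.
by rewrite /GRing.scale /GRing.mul /= (ext_mulE s t) (ext_scaleE a s) !opE; apply/ext_piP; exact: er_scaleAl.
Qed.
HB.instance Definition _ := GRing.Lmodule_isLalgebra.Build k ext ext_scalerAl.

Lemma ext_scalerAr (a : k) (x y : ext) : a *: (x * y) = x * (a *: y).
Proof.
elim/quotW: x => s; elim/quotW: y => t.
by rewrite /GRing.scale /GRing.mul /= (ext_mulE s t) (ext_scaleE a t) !opE; apply/ext_piP; exact: er_scaleAr.
Qed.
HB.instance Definition _ := GRing.Lalgebra_isAlgebra.Build k ext ext_scalerAr.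

Lemma ext_in_linear : linear ext_in.
Proof.
move=> a u v; rewrite /GRing.add /GRing.scale /= /ext_in (ext_scaleE a (TVar u)) !opE.
by apply/ext_piP; exact: er_linear.
Qed.
HB.instance Definition _ := GRing.isLinear.Build k V ext _ ext_in ext_in_linear.

Lemma ext_in_sq v : ext_in v * ext_in v = 0.
Proof.
by rewrite /GRing.mul /= /ext_in !opE; apply/ext_piP; exact: er_square.
Qed.

Lemma ext_in_anti u v : ext_in u * ext_in v = - (ext_in v * ext_in u).
Proof.
have := ext_in_sq (u + v).
rewrite linearD mulrDl !mulrDr !ext_in_sq add0r addr0 => /eqP.
by rewrite addr_eq0 => /eqP.
Qed.

Lemma ext_ind (P : ext -> Prop) :
  P 0 -> P 1 -> (forall v, P (ext_in v)) ->
  (forall x y, P x -> P y -> P (x + y)) ->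
  (forall x y, P x -> P y -> P (x * y)) ->
  (forall (a : k) x, P x -> P (a *: x)) -> forall x, P x.
Proof.
move=> P0 P1 PV PD PM PZ; elim/quotW; elim=> //.
- by move=> s IHs t IHt; rewrite -ext_addE; exact: PD.
- by move=> s IHs t IHt; rewrite -ext_mulE; exact: PM.
- by move=> a s IHs; rewrite -ext_scaleE; exact: PZ.
Qed.

Lemma ext_indl (P : ext -> Prop) :
  P 1 -> (forall v x, P x -> P (ext_in v * x)) ->
  (forall x y, P x -> P y -> P (x + y)) ->
  (forall (a : k) x, P x -> P (a *: x)) -> forall x, P x.
Proof.
move=> P1 PV PD PZ x.
suff /(_ 1 P1) : forall y, P y -> P (x * y) by rewrite mulr1.
elim/ext_ind: x => [y Py|y|v y|s t Ps Pt y Py|s t Ps Pt y Py|a s Ps y Py].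
- by rewrite mul0r -(scale0r y); exact: PZ.
- by rewrite mul1r.
- exact: PV.
- by rewrite mulrDl; apply: PD; [exact: Ps|exact: Pt].
- by rewrite -mulrA; apply/Ps/Pt.
- by rewrite -scalerAl; apply/PZ/Ps.
Qed.

Section Action.
Variables (M : lmodType k) (L : V -> M -> M).
Hypothesis Lr : forall v, linear (L v).
Hypothesis Ll : forall m, linear (L^~ m).
Hypothesis LL : forall v m, L v (L v m) = 0.

Lemma ext_actP : exists act : ext -> M -> M,
  [/\ forall x, linear (act x), forall m, linear (act^~ m),
      forall v m, act (ext_in v) m = L v m,
      forall m, act 1 m = m & forall x y m, act (x * y) m = act x (act y m)].
Proof.
exists (fun x => term_act L (repr x)).
have E s m : term_act L (repr (\pi_ext s)) m = term_act L s m.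
  exact: term_act_rel (ext_reprP s) m.
split.
- by move=> x; exact: term_act_linear.
- move=> m a; elim/quotW=> s; elim/quotW=> t.
  have -> : a *: \pi_ext s + \pi_ext t = \pi_ext (TAdd (TScale a s) t).
    by rewrite -ext_addE -ext_scaleE.
  by rewrite !E.
- by move=> v m; rewrite E.
- by move=> m; rewrite E.
- move=> + + m; elim/quotW=> s; elim/quotW=> t.
  have -> : \pi_ext s * \pi_ext t = \pi_ext (TMul s t) by rewrite -ext_mulE.
  by rewrite !E.
Qed.
End Action.

Lemma ext_universal (A : algType k) (f : {linear V -> A}) :
  (forall v, f v * f v = 0) ->
  exists2 phi : {lrmorphism ext -> A}, forall v, phi (ext_in v) = f v &
    forall psi : {lrmorphism ext -> A},
      (forall v, psi (ext_in v) = f v) -> psi =1 phi.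
Proof.
move=> ff.
have [|m a u v|v m|act [_ actl actV act1 actM]] :=
  @ext_actP A (fun v x => f v * x).
- by move=> v a x y; rewrite mulrDr scalerAr.
- by rewrite linearP mulrDl scalerAl.
- by rewrite mulrA ff mul0r.
pose phi x := act x 1.
have actE x m : act x m = phi x * m.
  elim/ext_indl: x m => [m|v x IH m|x y IHx IHy m|a x IH m].
  - by rewrite /phi !act1 mul1r.
  - by rewrite /phi !actM !actV IH mulrA.
  - have D z := actl z 1 x y; rewrite !scale1r in D.
    have {}D z : act (x + y) z = act x z + act y z.
      by have := actl z 1 x y; rewrite !scale1r.
    by rewrite /phi !D IHx IHy mulrDl.
  - have {}D z : act (a *: x) z = a *: act x z.
      have h0 : act 0 z = 0.
        by have := actl z (-1) 0 0; rewrite !scaleN1r oppr0 add0r addNr.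
      by have := actl z a x 0; rewrite h0 !addr0.
    by rewrite /phi !D IH scalerAl.
have phi_lin : linear phi by move=> a x y; exact: actl.
have phi_mul : monoid_morphism phi.
  split; first exact: act1.
  by move=> x y; rewrite {1}/phi actM actE.
pose phiL := GRing.isLinear.Build k ext A *:%R phi phi_lin.
pose phiM := GRing.isMonoidMorphism.Build ext A phi phi_mul.
pose phi' : {lrmorphism ext -> A} := HB.pack phi phiL phiM.
exists phi' => [v|psi psiV x]; first by rewrite /= /phi actV mulr1.
elim/ext_ind: x => [||v|x y IHx IHy|x y IHx IHy|a x IH].
- by rewrite !linear0.
- by rewrite !rmorph1.
- by rewrite psiV /= /phi actV mulr1.
- by rewrite (raddfD psi) (raddfD phi'); congr (_ + _).
- by rewrite (rmorphM psi) (rmorphM phi'); congr (_ * _).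
- by rewrite (linearZZ psi) (linearZZ phi'); congr (_ *: _).
Qed.

Lemma linear_of (U W : lmodType k) (f : U -> W) :
  linear f -> exists g : {linear U -> W}, g =1 f.
Proof.
move=> fl; pose F := GRing.isLinear.Build k U W *:%R f fl.
by exists (HB.pack_for {linear U -> W} f F).
Qed.

Lemma ext_recP (T : V -> ext -> ext) (c : k) :
  (forall v, linear (T v)) -> (forall w, linear (T^~ w)) ->
  (forall v w, T v (ext_in v * w) + c *: (ext_in v * T v w) = 0) ->
  exists d : {linear ext -> ext},
    d 1 = 0 /\ forall v w, d (ext_in v * w) = T v w + c *: (ext_in v * d w).
Proof.
move=> Tr Tl TT.
pose L v (p : ext * ext) : ext * ext :=
  (ext_in v * p.1, T v p.1 + c *: (ext_in v * p.2)).
have [|m a u v|v m|act [_ actl actV act1 actM]] := @ext_actP _ L.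
- move=> v a [x1 x2] [y1 y2]; rewrite /L /=; congr pair => /=.
    by rewrite mulrDr scalerAr.
  rewrite Tr mulrDr !scalerDr -!scalerAr !scalerA mulrC.
  by rewrite addrACA.
- rewrite /L; congr pair => /=; first by rewrite linearP mulrDl scalerAl.
  rewrite Tl linearP mulrDl !scalerDr -!scalerAl !scalerA mulrC.
  by rewrite addrACA.
- rewrite /L /= mulrA ext_in_sq mul0r mulrDr scalerDr addrA TT add0r.
  by rewrite -scalerAr mulrA ext_in_sq mul0r !scaler0.
pose f w := (act w (1, 0)).2.
have [|d dE] := @linear_of _ _ f.
  by move=> a x y; rewrite /f actl.
exists d; rewrite !dE /f act1; split=> // v w; rewrite !dE /f actM actV /=.
congr (T v _ + _).
elim/ext_indl: w => [|u x IH|x y IHx IHy|a x IH].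
- by rewrite act1.
- by rewrite actM actV /= IH.
- have := actl (1, 0) 1 x y; rewrite !scale1r => -> /=.
  by rewrite IHx IHy.
- have h0 : act 0 (1, 0) = 0.
    by have := actl (1,0) (-1) 0 0; rewrite !scaleN1r oppr0 add0r addNr.
  by have := actl (1, 0) a x 0; rewrite h0 !addr0 => -> /=; rewrite IH.
Qed.

End ExteriorAlgebra.

Definition wedge (k : fieldType) (V : lmodType k) n (x : 'I_n -> V) : ext V :=
  \prod_(i < n) ext_in (x i).

Section Degree.
Variables (k : fieldType) (V : lmodType k).
Implicit Types (n : nat) (w : ext V).

(* Lambda^n V is the span of the n-fold products of vectors; the scalars c i are
   only needed when n = 0. *)
Definition ext_homog n w : Prop :=
  exists m (c : 'I_m -> k) (x : 'I_m -> 'I_n -> V),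
    w = \sum_(i < m) c i *: wedge (x i).

Definition ext_degree n : {pred ext V} := fun w => `[< ext_homog n w >].

Lemma wedge_degree n (x : 'I_n -> V) : wedge x \in ext_degree n.
Proof.
by apply/asboolP; exists 1, (fun=> 1), (fun=> x); rewrite big_ord1 scale1r.
Qed.

Lemma ext_degree_closed n : subsemimod_closed (ext_degree n).
Proof.
split.
  split; first by apply/asboolP; exists 0, (fun=> 0), (fun _ _ => 0); rewrite big_ord0.
  move=> u v /asboolP[m [c [x ->]]] /asboolP[m' [c' [x' ->]]]; apply/asboolP.
  exists (m + m')%N.
  exists (fun i => match split i with inl j => c j | inr j => c' j end).
  exists (fun i => match split i with inl j => x j | inr j => x' j end).
  rewrite big_split_ord /=; congr (_ + _); apply: eq_bigr => i _.
    by rewrite (unsplitK (inl i)).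
  by rewrite (unsplitK (inr i)).
move=> a u /asboolP[m [c [x ->]]]; apply/asboolP.
exists m, (fun i => a * c i), x; rewrite scaler_sumr.
by apply: eq_bigr => i _; rewrite scalerA.
Qed.

HB.instance Definition _ n :=
  GRing.isSubmodClosed.Build k (ext V) (ext_degree n) (ext_degree_closed n).

Lemma ext_degree_ind n (P : ext V -> Prop) :
  P 0 -> (forall x : 'I_n -> V, P (wedge x)) ->
  (forall u v, P u -> P v -> P (u + v)) ->
  (forall (a : k) u, P u -> P (a *: u)) ->
  forall w, w \in ext_degree n -> P w.
Proof.
move=> P0 PW PD PZ w /asboolP[m [c [x ->]]].
by elim/big_ind: _ => // i _; apply: PZ.
Qed.

Definition ecat n m (x : 'I_n -> V) (y : 'I_m -> V) (i : 'I_(n + m)) : V :=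
  match split i with inl j => x j | inr j => y j end.

Lemma wedgeM n m (x : 'I_n -> V) (y : 'I_m -> V) :
  wedge x * wedge y = wedge (ecat x y).
Proof.
rewrite /wedge big_split_ord /=; congr (_ * _); apply: eq_bigr => i _.
  by rewrite /ecat (unsplitK (inl i)).
by rewrite /ecat (unsplitK (inr i)).
Qed.

Lemma ext_degreeM n m a b :
  a \in ext_degree n -> b \in ext_degree m -> a * b \in ext_degree (n + m).
Proof.
move=> an; elim/ext_degree_ind: an b => [b _|x b|u v IHu IHv b bm|c u IH b bm].
- by rewrite mul0r rpred0.
- elim/ext_degree_ind => [|y|u v IHu IHv|c u IH].
  + by rewrite mulr0 rpred0.
  + by rewrite wedgeM wedge_degree.
  + by rewrite mulrDr rpredD.
  + by rewrite -scalerAr rpredZ.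
- by rewrite mulrDl rpredD ?IHu ?IHv.
- by rewrite -scalerAl rpredZ ?IH.
Qed.

Lemma wedge1E (x : 'I_1 -> V) : wedge x = ext_in (x ord0).
Proof. by rewrite /wedge big_ord1. Qed.

Lemma wedge_recl n (x : 'I_n.+1 -> V) :
  wedge x = ext_in (x ord0) * wedge (fun i => x (lift ord0 i)).
Proof. by rewrite /wedge big_ord_recl. Qed.

Lemma ext_in_degree v : ext_in v \in ext_degree 1.
Proof. by rewrite -(wedge1E (fun=> v)) wedge_degree. Qed.

Lemma wedge2_degree u v : ext_in u * ext_in v \in ext_degree 2.
Proof. exact: (ext_degreeM (ext_in_degree u) (ext_in_degree v)). Qed.

Lemma wedge_central2 u w : u \in ext_degree 2 -> w * u = u * w.
Proof.
move=> u2; elim/ext_indl: w => [|v x IH|x y IHx IHy|a x IH].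
- by rewrite mul1r mulr1.
- rewrite -mulrA IH !mulrA; congr (_ * _).
  elim/ext_degree_ind: u2 {IH} => [|y|s t IHs IHt|a s IHs].
  + by rewrite mulr0 mul0r.
  + rewrite /wedge big_ord_recl big_ord1.
    by rewrite mulrA (ext_in_anti v) mulNr -[in LHS]mulrA (ext_in_anti v) mulrN opprK mulrA.
  + by rewrite mulrDr mulrDl IHs IHt.
  + by rewrite -scalerAr -scalerAl IHs.
- by rewrite mulrDl mulrDr IHx IHy.
- by rewrite -scalerAl -scalerAr IH.
Qed.

Lemma ext_linear_eq (W : lmodType k) (f g : {linear ext V -> W}) :
  (forall n (x : 'I_n -> V), f (wedge x) = g (wedge x)) -> f =1 g.
Proof.
move=> fg w.
have [m [c [p ->]]] : exists m (c : 'I_m -> k) (p : 'I_m -> {n & 'I_n -> V}),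
    w = \sum_(i < m) c i *: wedge (projT2 (p i)).
  elim/ext_indl: w => [|v x [m [c [p ->]]]|x y [m [c [p ->]]] [m' [c' [p' ->]]]|
    a x [m [c [p ->]]]].
  - exists 1, (fun=> 1), (fun=> existT _ 0 (fun=> 0)).
    by rewrite big_ord1 scale1r /wedge big_ord0.
  - exists m, c, (fun i => existT _ _ (ecat (fun _ : 'I_1 => v) (projT2 (p i)))).
    rewrite mulr_sumr; apply: eq_bigr => i _.
    by rewrite -wedgeM wedge1E scalerAr.
  - exists (m + m')%N.
    exists (fun i => match split i with inl j => c j | inr j => c' j end).
    exists (fun i => match split i with inl j => p j | inr j => p' j end).
    rewrite big_split_ord /=; congr (_ + _); apply: eq_bigr => i _.
      by rewrite (unsplitK (inl i)).
    by rewrite (unsplitK (inr i)).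
  - exists m, (fun i => a * c i), p; rewrite scaler_sumr.
    by apply: eq_bigr => i _; rewrite scalerA.
by rewrite !linear_sum; apply: eq_bigr => i _; rewrite !linearZZ fg.
Qed.

End Degree.

Arguments ext_degree {k} V n _.

Record extpow (k : fieldType) (V : lmodType k) (n : nat) : Type :=
  ExtPow { extpow_val : ext V; extpow_valP : extpow_val \in ext_degree V n }.

Section ExtPowInstances.
Variables (k : fieldType) (V : lmodType k) (n : nat).
HB.instance Definition _ := [isSub for @extpow_val k V n].
HB.instance Definition _ := [Choice of extpow V n by <:].
HB.instance Definition _ := [SubChoice_isSubLmodule of extpow V n by <:].

Lemma extpow_val_linear : linear (@extpow_val k V n).
Proof. by move=> a x y; exact: (linearP (\val : {linear extpow V n -> ext V})). Qed.
HB.instance Definition _ :=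
  GRing.isLinear.Build k (extpow V n) (ext V) _ (@extpow_val k V n) extpow_val_linear.
End ExtPowInstances.

Definition wedge2 (k : fieldType) (V : lmodType k) (u v : V) : extpow V 2 :=
  ExtPow (wedge2_degree u v).

Record is_alternating (k : fieldType) (V W : lmodType k) (b : V -> V -> W) : Prop :=
  IsAlternating {
    alt_linearl : forall v, linear (b^~ v);
    alt_linearr : forall u, linear (b u);
    alt_diag : forall v, b v v = 0 }.

Section Lift2.
Variables (k : fieldType) (V W : lmodType k) (b : V -> V -> W).
Hypothesis bP : is_alternating b.

Lemma ext_lift2_exists :
  exists! f : {linear extpow V 2 -> W}, forall u v, f (wedge2 u v) = b u v.
Proof.
pose M := (k^o * (V * W))%type.
pose L v (p : M) : M := (0, (p.1 *: v, b v p.2.1)).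
have [|m a u v|v m|act [_ actl actV act1 actM]] := @ext_actP k V M L.
- move=> v a [x1 [x2 x3]] [y1 [y2 y3]]; rewrite /L /=.
  congr (_, (_, _)) => /=; first by rewrite scaler0 addr0.
    by rewrite scalerDl -scalerA.
  exact: (alt_linearr bP).
- rewrite /L; congr (_, (_, _)) => /=; first by rewrite scaler0 addr0.
    by rewrite scalerDr !scalerA mulrC.
  exact: (alt_linearl bP).
- rewrite /L /= scale0r; congr (_, (_, _)).
  have := alt_linearr bP v (m.1) v 0; rewrite addr0 => ->.
  have h0 : b v 0 = 0.
    by have := alt_linearr bP v (-1) 0 0; rewrite !scaleN1r oppr0 add0r addNr.
  by rewrite h0 addr0 (alt_diag bP) scaler0.
have [|f fE] := @linear_of k (extpow V 2) W
    (fun w => (act (extpow_val w) (1, 0)).2.2).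
  by move=> a x y; rewrite linearP actl.
have fV u v : f (wedge2 u v) = b u v.
  by rewrite fE /= actM !actV /= scale1r.
exists f; split=> // g gV; apply: linear_ext => -[w wP].
have [m [c [x wE]]] := asboolP _ wP.
have -> : ExtPow wP = \sum_(i < m) c i *: wedge2 (x i ord0) (x i ord_max).
  apply: val_inj; rewrite /= wE raddf_sum; apply: eq_bigr => i _ /=.
  rewrite /wedge big_ord_recl big_ord1; congr (_ *: (_ * ext_in (x i _))).
  exact: val_inj.
by rewrite !linear_sum; apply: eq_bigr => i _; rewrite !linearZZ fV gV.
Qed.

Definition ext_lift2 : {linear extpow V 2 -> W} := definite ext_lift2_exists.

Lemma ext_lift2E u v : ext_lift2 (wedge2 u v) = b u v.
Proof. exact: (definiteP ext_lift2_exists). Qed.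
End Lift2.

Section Derivations.
Variables (k : fieldType) (V : lmodType k).

Definition is_derivation_of (f : {linear V -> V}) (d : {linear ext V -> ext V}) :=
  (forall v, d (ext_in v) = ext_in (f v)) /\
  (forall a b, d (a * b) = d a * b + a * d b).

Lemma ext_der_exists f : exists! d, is_derivation_of f d.
Proof.
have [|w a u v|v w|d [d1 dV]] :=
  @ext_recP k V (fun v w => ext_in (f v) * w) 1.
- by move=> v a x y; rewrite mulrDr scalerAr.
- by rewrite !linearP mulrDl scalerAl.
- by rewrite scale1r !mulrA -mulrDl [_ * ext_in v]ext_in_anti addNr mul0r.
have dV' v : d (ext_in v) = ext_in (f v).
  by have := dV v 1; rewrite !mulr1 d1 mulr0 scaler0 addr0.
exists d; split.
  split=> // a b; elim/ext_indl: a => [|v x IH|x y IHx IHy|c x IH].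
  - by rewrite d1 !mul1r mul0r add0r.
  - by rewrite -mulrA !dV IH !scale1r mulrDr mulrDl !mulrA addrA.
  - by rewrite mulrDl !linearD /= IHx IHy !mulrDl addrACA.
  - by rewrite -scalerAl !linearZZ IH scalerDr -!scalerAl.
move=> d' [d'V d'M]; apply: linear_ext => w.
have d'1 : d' 1 = 0.
  have := d'M 1 1; rewrite !mulr1 !mul1r => /eqP.
  by rewrite -[X in X == _]addr0 (inj_eq (addrI _)) eq_sym => /eqP.
elim/ext_indl: w => [|v x IH|x y IHx IHy|c x IH].
- by rewrite d1 d'1.
- by rewrite dV d'M d'V scale1r IH.
- by rewrite !linearD /= IHx IHy.
- by rewrite !linearZZ IH.
Qed.

Definition ext_der f : {linear ext V -> ext V} := definite (ext_der_exists f).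

Lemma ext_derP f : is_derivation_of f (ext_der f).
Proof. exact: (definiteP (ext_der_exists f)). Qed.

Lemma ext_der1 f : ext_der f 1 = 0.
Proof.
have := (ext_derP f).2 1 1; rewrite !mulr1 !mul1r => /eqP.
by rewrite -[X in X == _]addr0 (inj_eq (addrI _)) eq_sym => /eqP.
Qed.

Lemma ext_der_wedge f n (x : 'I_n -> V) :
  ext_der f (wedge x) = \sum_(i < n) wedge (fun j => if j == i then f (x j) else x j).
Proof.
elim: n x => [|n IH] x; first by rewrite /wedge !big_ord0 ext_der1.
rewrite wedge_recl (ext_derP f).2 (ext_derP f).1 IH big_ord_recl; congr (_ + _).
  by rewrite wedge_recl.
rewrite mulr_sumr; apply: eq_bigr => i _; rewrite [RHS]wedge_recl /=.
by congr (_ * _); apply: eq_bigr => j _; rewrite (inj_eq lift_inj).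
Qed.

Lemma ext_der_wedge_front f n (x : 'I_n -> V) :
  ext_der f (wedge x) = \sum_(i < n)
    (-1) ^+ i *: (ext_in (f (x i)) * \prod_(j < n | j != i) ext_in (x j)).
Proof.
elim: n x => [|n IH] x; first by rewrite /wedge !big_ord0 ext_der1.
rewrite wedge_recl (ext_derP f).2 (ext_derP f).1 IH big_ord_recl; congr (_ + _).
  by rewrite expr0 scale1r big_mkcond big_ord_recl /= mul1r.
rewrite mulr_sumr; apply: eq_bigr => i _.
rewrite [in RHS]big_mkcond big_ord_recl -big_mkcond /=.
rewrite -scalerAr [in LHS]mulrA (ext_in_anti (x ord0)) mulNr -mulrA scalerN -scaleNr.
rewrite exprS mulN1r.
by congr (_ *: (_ * (_ * _))); apply: eq_bigl => j; rewrite (inj_eq lift_inj).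
Qed.

Definition is_superderivation_of (delta : {linear V -> extpow V 2})
    (d : {linear ext V -> ext V}) : Prop :=
  [/\ forall n a, a \in ext_degree V n -> d a \in ext_degree V n.+1,
      forall v, d (ext_in v) = extpow_val (delta v) &
      forall n a b, a \in ext_degree V n ->
        d (a * b) = d a * b + (-1) ^+ n *: (a * d b)].

Lemma ext_super_exists delta : exists! d, is_superderivation_of delta d.
Proof.
have dl a u v : extpow_val (delta (a *: u + v)) =
    a *: extpow_val (delta u) + extpow_val (delta v) by rewrite linearP.
have [|w a u v|v w|d [d1 dV]] :=
  @ext_recP k V (fun v w => extpow_val (delta v) * w) (-1).
- by move=> v a x y; rewrite mulrDr scalerAr.
- by rewrite dl mulrDl scalerAl.
- by rewrite scaleN1r !mulrA (wedge_central2 _ (extpow_valP _)) subrr.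
have dV' v : d (ext_in v) = extpow_val (delta v).
  by have := dV v 1; rewrite !mulr1 d1 mulr0 scaler0 addr0.
have dW n (x : 'I_n -> V) : d (wedge x) \in ext_degree V n.+1.
  elim: n x => [|n IH] x; first by rewrite /wedge big_ord0 d1 rpred0.
  rewrite wedge_recl dV rpredD //.
    exact: (ext_degreeM (extpow_valP _) (wedge_degree _)).
  by rewrite rpredZ // (ext_degreeM (ext_in_degree _) (IH _)).
exists d; split.
  split=> //.
    move=> n a; elim/ext_degree_ind => [|x|u v IHu IHv|c u IH] //.
    - by rewrite linear0 rpred0.
    - by rewrite linearD rpredD.
    - by rewrite linearZZ rpredZ.
  move=> n a b; elim/ext_degree_ind => [|x|u v IHu IHv|c u IH].
  - by rewrite mul0r !linear0 !mul0r scaler0 addr0.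
  - elim: n x => [|n IH] x.
      by rewrite /wedge big_ord0 d1 !mul1r mul0r add0r expr0 scale1r.
    rewrite !wedge_recl -mulrA !dV IH mulrDr mulrDl -!scalerAl -!scalerAr.
    by rewrite !mulrA scalerDr scalerA addrA exprS.
  - by rewrite mulrDl !linearD /= IHu IHv !mulrDl scalerDr addrACA.
  - by rewrite -scalerAl !linearZZ IH scalerDr -!scalerAl !scalerA mulrC.
move=> d' [_ d'V d'M]; apply: linear_ext => w.
have d'1 : d' 1 = 0.
  have one0 : 1 \in ext_degree V 0.
    by have := @wedge_degree k V 0 (fun=> 0); rewrite /wedge big_ord0.
  have := d'M 0 1 1 one0; rewrite !mulr1 !mul1r expr0 scale1r => /eqP.
  by rewrite -[X in X == _]addr0 (inj_eq (addrI _)) eq_sym => /eqP.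
elim/ext_indl: w => [|v x IH|x y IHx IHy|c x IH].
- by rewrite d1 d'1.
- by rewrite dV (d'M 1 _ _ (ext_in_degree v)) d'V expr1 IH.
- by rewrite !linearD /= IHx IHy.
- by rewrite !linearZZ IH.
Qed.

Definition ext_super delta : {linear ext V -> ext V} := definite (ext_super_exists delta).

Lemma ext_superP delta : is_superderivation_of delta (ext_super delta).
Proof. exact: (definiteP (ext_super_exists delta)). Qed.

End Derivations.

Record is_lie_bracket (k : fieldType) (g : lmodType k) (br : g -> g -> g) : Prop :=
  IsLieBracket {
    lie_alt : is_alternating br;
    lie_jacobi : forall x y z,
      br x (br y z) + br y (br z x) + br z (br x y) = 0 }.

Record lieAlgebra (k : fieldType) : Type := LieAlgebra {
  lie_sort :> lmodType k;
  lie_bracket : lie_sort -> lie_sort -> lie_sort;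
  lie_bracketP : is_lie_bracket lie_bracket }.

Section LieAlgebra.
Variables (k : fieldType) (g : lieAlgebra k).

Definition ad (x : g) : g -> g := fun y => lie_bracket x y.
HB.instance Definition _ (x : g) :=
  GRing.isLinear.Build k g g _ (ad x) (alt_linearr (lie_alt (lie_bracketP g)) x).

Definition bracket_map : {linear extpow g 2 -> g} :=
  ext_lift2 (lie_alt (lie_bracketP g)).

(* Indices start at 0 instead of 1, which leaves (-1)^(i+j) unchanged. *)
Definition is_CE_differential (d : {linear ext g -> ext g}) : Prop :=
  forall n (x : 'I_n -> g), d (wedge x) =
    \sum_(i < n) \sum_(j < n | (i < j)%N) (-1) ^+ (i + j) *:
      (ext_in (lie_bracket (x i) (x j)) * \prod_(l < n | (l != i) && (l != j)) ext_in (x l)).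

Lemma CE_exists : exists! d, is_CE_differential d.
Proof.
have derl a u v w : ext_der (ad (a *: u + v)) w =
    a *: ext_der (ad u) w + ext_der (ad v) w.
  elim/ext_indl: w => [|y x IH|x y IHx IHy|c x IH].
  - by rewrite !ext_der1 scaler0 addr0.
  - rewrite !(ext_derP _).2 !(ext_derP _).1 IH.
    have adE : ad (a *: u + v) y = a *: ad u y + ad v y.
      exact: (alt_linearl (lie_alt (lie_bracketP g))).
    by rewrite /= adE !linearP mulrDl mulrDr scalerDr -scalerAl -scalerAr addrACA.
  - by rewrite !linearD /= IHx IHy ?scalerDr addrACA.
  - rewrite (linearZZ (ext_der (ad (a *: u + v)))) IH scalerDr.
    rewrite (linearZZ (ext_der (ad u))) (linearZZ (ext_der (ad v))).
    by rewrite !scalerA mulrC.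
have [|w a u v|v w|d [d1 dV]] :=
  @ext_recP k g (fun v w => - ext_der (ad v) w) (-1).
- by move=> v a x y; rewrite linearP opprD scalerN.
- by rewrite derl opprD scalerN.
- rewrite (ext_derP _).2 (ext_derP _).1 scaleN1r mulrN opprK opprD.
  have avv : ad v v = 0 by exact: (alt_diag (lie_alt (lie_bracketP g))).
  by rewrite /= avv linear0 mul0r oppr0 add0r addNr.
have dW : is_CE_differential d.
  move=> n; elim: n => [|n IH] x; first by rewrite /wedge !big_ord0.
  rewrite wedge_recl dV big_ord_recl; congr (_ + _).
    rewrite ext_der_wedge_front -sumrN [RHS]big_mkcond big_ord_recl /= add0r.
    rewrite [LHS]big_mkcond; apply: eq_bigr => i _ /=.
    rewrite add0n exprS mulN1r scaleNr; congr (- (_ *: (_ * _))).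
    rewrite [RHS]big_mkcond big_ord_recl /= mul1r -big_mkcond /=.
    by apply: eq_bigl => j; rewrite (inj_eq lift_inj).
  rewrite IH mulr_sumr scaler_sumr; apply: eq_bigr => i _.
  rewrite [RHS]big_mkcond big_ord_recl /= add0r -big_mkcond /=.
  rewrite mulr_sumr scaler_sumr; apply: eq_big => // j _.
  rewrite addSn addnS !exprS !mulN1r opprK scaleN1r -scalerAr -scalerN.
  congr (_ *: _); rewrite [in LHS]mulrA (ext_in_anti (x ord0)) mulNr opprK -mulrA.
  congr (_ * _).
  by rewrite [RHS]big_mkcond big_ord_recl -big_mkcond.
exists d; split=> // d' d'W; apply/linear_ext/ext_linear_eq => n x.
by rewrite dW d'W.
Qed.

Definition CE_differential : {linear ext g -> ext g} := definite CE_exists.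

Lemma CE_differentialP : is_CE_differential CE_differential.
Proof. exact: (definiteP CE_exists). Qed.

End LieAlgebra.

Section Dual.
Variables (k : fieldType) (V : lmodType k).

Definition dual : Type := {linear V -> k^o}.
Implicit Types f h : dual.

HB.instance Definition _ := gen_eqMixin dual.
HB.instance Definition _ := gen_choiceMixin dual.

Definition dual_zero : dual := \0.
Definition dual_add f h : dual := f \+ h.
Definition dual_opp f : dual := \- f.
Definition dual_scale (a : k) f : dual := a \*: f.

Lemma dual_addA : associative dual_add.
Proof. by move=> f g h; apply: linear_ext => x; exact: addrA. Qed.
Lemma dual_addC : commutative dual_add.
Proof. by move=> f g; apply: linear_ext => x; exact: addrC. Qed.
Lemma dual_add0 : left_id dual_zero dual_add.
Proof. by move=> f; apply: linear_ext => x; exact: add0r. Qed.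
Lemma dual_addN : left_inverse dual_zero dual_opp dual_add.
Proof. by move=> f; apply: linear_ext => x; exact: addNr. Qed.
HB.instance Definition _ :=
  GRing.isZmodule.Build dual dual_addA dual_addC dual_add0 dual_addN.

Lemma dual_scaleA a b f : dual_scale a (dual_scale b f) = dual_scale (a * b) f.
Proof. by apply: linear_ext => x; exact: scalerA. Qed.
Lemma dual_scale1 : left_id 1 dual_scale.
Proof. by move=> f; apply: linear_ext => x; exact: scale1r. Qed.
Lemma dual_scaleDr : right_distributive dual_scale +%R.
Proof. by move=> a f g; apply: linear_ext => x; exact: scalerDr. Qed.
Lemma dual_scaleDl f : {morph dual_scale^~ f : a b / a + b}.
Proof. by move=> a b; apply: linear_ext => x; exact: scalerDl. Qed.
HB.instance Definition _ := GRing.Zmodule_isLmodule.Build k dual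
  dual_scaleA dual_scale1 dual_scaleDr dual_scaleDl.

Definition det2 f h (x y : V) : k^o := f x * h y - f y * h x.

Lemma det2_alt f h : is_alternating (det2 f h).
Proof.
split=> [v|u|v]; rewrite /det2; last by rewrite mulrC subrr.
  move=> a x y; rewrite (linearP f) (linearP h) mulrDl mulrDr opprD.
  by rewrite addrACA scalerBr scalerAl scalerAr.
move=> a x y; rewrite (linearP f) (linearP h) mulrDl mulrDr opprD.
by rewrite addrACA scalerBr scalerAr scalerAl.
Qed.

(* f /\ h as the linear form x /\ y |-> f x * h y - f y * h x on Lambda^2 V *)
Definition wedge_form f h : {linear extpow V 2 -> k^o} := ext_lift2 (det2_alt f h).

(* delta^* : Lambda^2 V^* -> V^*, viewed as the binary operation
   (f, h) |-> delta^*(f /\ h) *)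
Definition dual_bracket (delta : {linear V -> extpow V 2}) f h : dual :=
  wedge_form f h \o delta.

End Dual.

Record lieBialgebra (k : fieldType) : Type := LieBialgebra {
  bialg_lie :> lieAlgebra k;
  cobracket : {linear bialg_lie -> extpow bialg_lie 2};
  cojacobi : is_lie_bracket (dual_bracket cobracket);
  cocycle : forall x y : bialg_lie,
    extpow_val (cobracket (lie_bracket x y)) =
      ext_der (ad x) (extpow_val (cobracket y)) -
      ext_der (ad y) (extpow_val (cobracket x)) }.

Section Bialgebra.
Variables (k : fieldType) (g : lieBialgebra k).

Definition cobracket_differential : {linear ext g -> ext g} :=
  ext_super (cobracket g).

Definition bracket_cobracket : {linear g -> g} := @bracket_map k g \o cobracket g.

End Bialgebra.

(* Main.v *)
(* Write [b] for the Chevalley-Eilenberg differential and [d] for the cobracket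
   differential.  For [v] in [g],
     b (v w) = - ad_v w - v (b w)   and   d (v w) = delta(v) w - v (d w),
   so expanding [b d + d b] on [v w] and inducting on [w] reduces the theorem to
     d (ad_v w) - ad_v (d w) = b (delta(v) w) - delta(v) (b w) + D(v) w.
   For [delta v = sum a c] the right-hand side is [sum (a ad_c w - c ad_a w)].  Hence
   both sides are superderivations of degree 1 in [w], and on [g] they agree by the
   cocycle condition. *)
Require Import Defs.
From HB Require Import structures.
From mathcomp Require Import all_boot all_algebra.
From mathcomp Require Import boolp.

Set Implicit Arguments.
Unset Strict Implicit.
Unset Printing Implicit Defensive.

Import GRing.Theory.
Local Open Scope ring_scope.

Lemma extpow2_ind (k : fieldType) (V : lmodType k) (P : extpow V 2 -> Prop) :
  P 0 -> (forall u v, P (wedge2 u v)) ->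
  (forall u v, P u -> P v -> P (u + v)) ->
  (forall (a : k) u, P u -> P (a *: u)) -> forall u, P u.
Proof.
move=> P0 PW PD PZ [w wP].
have [m [c [x wE]]] := asboolP _ wP.
have -> : ExtPow wP = \sum_(i < m) c i *: wedge2 (x i ord0) (x i (lift ord0 ord0)).
  apply: val_inj; rewrite /= wE raddf_sum; apply: eq_bigr => i _ /=.
  by rewrite /wedge big_ord_recl big_ord1.
by elim/big_ind: _ => // i _; apply/PZ/PW.
Qed.

Lemma ext_der_in (k : fieldType) (V : lmodType k) (f : {linear V -> V}) x :
  ext_der f (ext_in x) = ext_in (f x).
Proof. exact: (ext_derP f).1. Qed.

Lemma ext_derM (k : fieldType) (V : lmodType k) (f : {linear V -> V}) s t :
  ext_der f (s * t) = ext_der f s * t + s * ext_der f t.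
Proof. exact: (ext_derP f).2. Qed.

Lemma ext_superMl (k : fieldType) (V : lmodType k)
    (delta : {linear V -> extpow V 2}) v w :
  ext_super delta (ext_in v * w) =
    extpow_val (delta v) * w - ext_in v * ext_super delta w.
Proof.
have [_ dV dM] := ext_superP delta.
by rewrite (dM 1 _ _ (ext_in_degree v)) dV expr1 scaleN1r.
Qed.

Lemma ext_super1 (k : fieldType) (V : lmodType k)
    (delta : {linear V -> extpow V 2}) : ext_super delta 1 = 0.
Proof.
have [_ _ dM] := ext_superP delta.
have one0 : 1 \in ext_degree V 0.
  by have := @wedge_degree k V 0 (fun=> 0); rewrite /wedge big_ord0.
have := dM 0 1 1 one0; rewrite expr0 scale1r !mul1r mulr1 => /esym/eqP.
by rewrite -subr_eq0 addrK => /eqP.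
Qed.

Section CE.
Variables (k : fieldType) (g : lieAlgebra k).
Implicit Types (v x y : g) (u : extpow g 2) (w : ext g).
Local Notation b := (CE_differential g).

Lemma CE_differential1 : b 1 = 0.
Proof.
by have := CE_differentialP (fun _ : 'I_0 => 0 : g); rewrite /wedge !big_ord0.
Qed.

Lemma CE_differentialMl v w :
  b (ext_in v * w) = - ext_der (ad v) w - ext_in v * b w.
Proof.
have [f fE] : exists f : {linear ext g -> ext g},
    f =1 fun w => b (ext_in v * w).
  by apply: linear_of => a s t; rewrite mulrDr -scalerAr linearP.
have [h hE] : exists h : {linear ext g -> ext g},
    h =1 fun w => - ext_der (ad v) w - ext_in v * b w.
  apply: linear_of => a s t.
  rewrite (linearP (ext_der _)) (linearP b) mulrDr -scalerAr !opprD.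
  by rewrite addrACA scalerBr !scalerN.
rewrite -fE -hE; apply: ext_linear_eq => n x; rewrite fE hE.
pose X (i : 'I_n.+1) := if unlift ord0 i is Some j then x j else v.
have X0 : X ord0 = v by rewrite /X unlift_none.
have XS j : X (lift ord0 j) = x j by rewrite /X liftK.
have -> : ext_in v * wedge x = wedge X.
  by rewrite wedge_recl X0; congr (_ * _); apply: eq_bigr => i _; rewrite XS.
rewrite !CE_differentialP big_ord_recl; congr (_ + _).
  rewrite ext_der_wedge_front -sumrN big_mkcond big_ord_recl /= add0r.
  apply: eq_bigr => i _ /=; rewrite X0 XS add0n exprS mulN1r scaleNr.
  congr (- (_ *: (_ * _))); rewrite big_mkcond big_ord_recl /= mul1r -big_mkcond.
  by apply: eq_big => j; rewrite ?XS ?(inj_eq lift_inj).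
rewrite mulr_sumr -sumrN; apply: eq_bigr => i _.
rewrite big_mkcond big_ord_recl /= add0r -big_mkcond mulr_sumr -sumrN.
apply: eq_big => // j _.
rewrite addSn addnS !exprS !mulN1r opprK -scalerAr -scalerN; congr (_ *: _).
rewrite big_mkcond big_ord_recl /= X0 !XS mulrA ext_in_anti mulNr -mulrA.
rewrite -big_mkcond; congr (- (_ * (_ * _))).
by apply: eq_big => l; rewrite ?XS ?(inj_eq lift_inj).
Qed.

Lemma ad_anti x y : ad x y = - ad y x.
Proof.
have brP := lie_alt (lie_bracketP g).
have brl := alt_linearl brP; have brr := alt_linearr brP.
have := alt_diag brP (1 *: x + y).
rewrite brl !brr !scale1r !(alt_diag brP) add0r addr0 => /eqP.
by rewrite addr_eq0 => /eqP.
Qed.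

Definition CE_defect (u : extpow g 2) w : ext g :=
  b (extpow_val u * w) - extpow_val u * b w + ext_in (bracket_map g u) * w.

Lemma CE_defectD (t u : extpow g 2) w : CE_defect (t + u) w = CE_defect t w + CE_defect u w.
Proof.
rewrite /CE_defect !linearD /= !mulrDl linearD opprD.
by rewrite [X in X + _]addrACA [LHS]addrACA.
Qed.

Lemma CE_defectZ a u w : CE_defect (a *: u) w = a *: CE_defect u w.
Proof.
by rewrite /CE_defect !linearZZ -!scalerAl linearZZ scalerDr scalerBr.
Qed.

Lemma CE_defect0 w : CE_defect 0 w = 0.
Proof. by rewrite -(scale0r 0) CE_defectZ scale0r. Qed.

Lemma CE_defectDr u s t : CE_defect u (s + t) = CE_defect u s + CE_defect u t.
Proof.
rewrite /CE_defect mulrDr !(linearD b) !mulrDr opprD.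
by rewrite [X in X + _]addrACA [LHS]addrACA.
Qed.

Lemma CE_defectZr a u w : CE_defect u (a *: w) = a *: CE_defect u w.
Proof.
rewrite /CE_defect -scalerAr !(linearZZ b) -!scalerAr.
by rewrite scalerDr scalerBr.
Qed.

Lemma CE_defect_wedge2 x y w : CE_defect (wedge2 x y) w =
  ext_in x * ext_der (ad y) w - ext_in y * ext_der (ad x) w.
Proof.
rewrite /CE_defect /bracket_map ext_lift2E /= -!mulrA !CE_differentialMl.
rewrite ext_derM ext_der_in mulrBr mulrN !opprD !opprK.
rewrite !addrA addrK addrAC [RHS]addrC; congr (_ + _).
by rewrite addrAC addNr add0r.
Qed.

Lemma CE_defect1 u : CE_defect u 1 = 0.
Proof.
elim/extpow2_ind: u => [|x y|u v IHu IHv|a u IH].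
- exact: CE_defect0.
- by rewrite CE_defect_wedge2 !ext_der1 !mulr0 subr0.
- by rewrite CE_defectD IHu IHv addr0.
- by rewrite CE_defectZ IH scaler0.
Qed.

Lemma CE_defectMl u y w : CE_defect u (ext_in y * w) =
  - (ext_der (ad y) (extpow_val u) * w) - ext_in y * CE_defect u w.
Proof.
elim/extpow2_ind: u => [|x z|u v IHu IHv|a u IH].
- by rewrite !CE_defect0 !linear0 mul0r mulr0 oppr0 addr0.
- rewrite !CE_defect_wedge2 /= !ext_derM !ext_der_in /=.
  rewrite (ad_anti z) (ad_anti x) !linearN /= !mulNr !mulrDr mulrDl !mulrN.
  rewrite !mulrA !opprD !opprK (ext_in_anti z (ad y x)) !(ext_in_anti y) !mulNr !opprK.
  by rewrite addrACA [X in X + _]addrC.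
- rewrite !CE_defectD IHu IHv !linearD /= mulrDl [_ * (CE_defect u w + _)]mulrDr.
  by rewrite !opprD addrACA.
- by rewrite !CE_defectZ IH !linearZZ -scalerAl -scalerAr scalerBr scalerN.
Qed.

End CE.

Section Bialgebra.
Variables (k : fieldType) (g : lieBialgebra k).
Implicit Types (v : g) (w : ext g).
Local Notation d := (cobracket_differential g).

Lemma cobracket_differential_ad v w :
  d (ext_der (ad v) w) - ext_der (ad v) (d w) = CE_defect (cobracket g v) w.
Proof.
rewrite /cobracket_differential.
elim/ext_indl: w => [|y w IH|s t IHs IHt|a s IH].
- by rewrite ext_der1 ext_super1 !linear0 addr0 CE_defect1.
- rewrite CE_defectMl -IH ext_derM ext_der_in linearD !ext_superMl linearB /=.
  rewrite !ext_derM ext_der_in /= [ad v y]/(lie_bracket v y) cocycle.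
  rewrite mulrBl mulrBr !opprD !opprK !addrA.
  by rewrite [LHS](ACl ((1*6)*(3*8)*(4*7)*2*(5*9)))%AC /= !subrr addNr !add0r !addrA.
- by rewrite CE_defectDr -IHs -IHt !linearD /= addrACA.
- by rewrite CE_defectZr -IH scalerBr -!linearZZ.
Qed.

End Bialgebra.

Theorem theorem4p1 (k : fieldType) (g : lieBialgebra k) (w : ext g) :
  CE_differential g (cobracket_differential g w) +
  cobracket_differential g (CE_differential g w) =
  - ext_der (bracket_cobracket g) w.
Proof.
set b := CE_differential g; set d := cobracket_differential g.
elim/ext_indl: w => [|v w IH|s t IHs IHt|a s IH].
- by rewrite CE_differential1 /cobracket_differential ext_super1 !linear0
    ext_der1 oppr0 addr0.
- have bM : b (extpow_val (cobracket g v) * w) =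
      d (ext_der (ad v) w) - ext_der (ad v) (d w) +
      extpow_val (cobracket g v) * b w -
      ext_in (bracket_cobracket g v) * w.
    by rewrite cobracket_differential_ad /CE_defect addrAC addrK subrK.
  rewrite ext_derM ext_der_in opprD -[- (ext_in v * _)]mulrN -IH CE_differentialMl.
  rewrite [d (_ * _)]ext_superMl (linearB b) (linearB d) (linearN d) /= bM.
  rewrite CE_differentialMl [d (_ * _)]ext_superMl mulrDr !opprD !opprK !addrA.
  by rewrite [LHS](ACl ((1*7)*(2*5)*(3*8)*4*6*9))%AC /= !subrr addNr !add0r.
- by rewrite !linearD /= addrACA IHs IHt -opprD.
- rewrite (linearZZ d) !(linearZZ b) (linearZZ d) (linearZZ (ext_der _)).
  by rewrite -scalerDr IH scalerN.
Qed.
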